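(* Let $n\ge 3$. The set of vertices of the cyclopermutohedron $\mathcal{CP}_{n+1}$ equals the set of vertices of the standard permutohedron $\Pi_n$: $$\mathrm{Vert}(\mathcal{CP}_{n+1})=\mathrm{Vert}(\Pi_n).$$
   Context: Standard permutohedron: $\Pi_n\subset\mathbb{R}^n$ is the convex hull of all points obtained by permuting the coordinates of $(1,2,\dots,n)$. Virtual polytopes: convex polytopes in $\mathbb{R}^n$ form a cancellative commutative semigroup under Minkowski addition; virtual polytopes are the elements of its Grothendieck group, i.e. formal differences $L-M$ with $L_1-M_1=L_2-M_2$ iff $L_1+M_2=L_2+M_1$. For a convex polytope $K$ and $\xi\in\mathbb{R}^n$, $K^\xi=\{x\in K:\ (x,\xi)\ge (y,\xi)\ \forall y\in K\}$; for a virtual polytope, $(L-M)^\xi:=L^\xi-M^\xi$ (well defined). The virtual polytopes $K^\xi$ are the faces of $K$. The vertices of a virtual polytope are its $0$-dimensional faces, i.e. those faces that are (differences of) single points, identified with points of $\mathbb{R}^n$ via $\{a\}-\{b\}=\{a-b\}$. Cyclopermutohedron: let $e_1,\dots,e_n$ be the standard basis of $\mathbb{R}^n$, $S=(1,\dots,1)$, $R_i=\sum_{j=1}^n(e_i-e_j)$ (the vector with $i$-th coordinate $n-1$ and all other coordinates $-1$), $q_{ij}=[e_i,e_j]$ for $i<j$, and $r_i=[0,R_i]$. Then $\mathcal{CP}_{n+1}$ is the virtual polytope $$\mathcal{CP}_{n+1}=\sum_{i<j}q_{ij}+S-\sum_{i=1}^n r_i .$$ *)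

(* Defs.v *)
From HB Require Import structures.
From mathcomp Require Import all_boot all_order all_algebra perm.
From mathcomp Require Import all_classical all_reals all_analysis.
From mathcomp Require Import ring.
Import Order.TTheory GRing.Theory Num.Theory.
Import numFieldNormedType.Exports.

Set Implicit Arguments.
Unset Strict Implicit.
Unset Printing Implicit Defensive.

Local Open Scope classical_set_scope.
Local Open Scope ring_scope.
Local Open Scope quotient_scope.

Section ConvexHull.
Variables (R : realType) (M : lmodType R).
Implicit Types (A C : set M).

Definition conv_hull A : set M := smallest (@convex_set R M) A.

Lemma convex_setE C : @convex_set R M C <->
  forall x y (t : R), C x -> C y -> 0 <= t -> t <= 1 ->
    C (t *: x + (1 - t) *: y).
Proof.
split=> [cC x y t Cx Cy t0 t1 | cC x y l /set_mem Cx /set_mem Cy].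
  have tP : 0 <= t <= 1 by rewrite t0 t1.
  have := cC x y (Itv01 t0 t1) (mem_set Cx) (mem_set Cy).
  by move/set_mem.
by apply/mem_set/cC.
Qed.

Lemma sub_conv_hull A : A `<=` conv_hull A.
Proof. exact: sub_smallest. Qed.

Lemma conv_hull_convex A x y (t : R) : conv_hull A x -> conv_hull A y ->
  0 <= t -> t <= 1 -> conv_hull A (t *: x + (1 - t) *: y).
Proof.
move=> Ax Ay t0 t1 C CA; have [cC _] := CA.
by apply: (convex_setE C).1 => //; [exact: Ax|exact: Ay].
Qed.

Lemma convex_comb C (I : eqType) (r : seq I) (w : I -> R) (p : I -> M) :
  @convex_set R M C -> (forall i, 0 <= w i) -> (forall i, C (p i)) ->
  0 < \sum_(i <- r) w i ->
  C ((\sum_(i <- r) w i)^-1 *: \sum_(i <- r) w i *: p i).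
Proof.
move=> cC w0 Cp; elim: r => [|i r IH]; rewrite ?big_nil ?ltxx//.
rewrite !big_cons; set W := \sum_(j <- r) w j; set P := \sum_(j <- r) _.
have W0 : 0 <= W by apply: sumr_ge0.
move: W0; rewrite le_eqVlt => /predU1P[W0|Wgt0] wW.
  have P0 : P = 0.
    rewrite /P big_seq big1// => j jr; have /eqP := esym W0.
    rewrite psumr_eq0// => /allP /(_ j jr) /= /eqP ->.
    by rewrite scale0r.
  move: wW; rewrite P0 -W0 !addr0 => wi0.
  by rewrite scalerA mulVf ?gt_eqF// scale1r.
rewrite (_ : _ *: (_ + _) = (w i / (w i + W)) *: p i +
    (1 - w i / (w i + W)) *: (W^-1 *: P)).
  apply: (convex_setE C).1 => //; first exact: IH.
    by rewrite divr_ge0// ltW.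
  by rewrite ler_pdivrMr// mul1r lerDl ltW.
have [wW0 W0] : w i + W != 0 /\ W != 0 by rewrite !gt_eqF.
by rewrite scalerDr !scalerA; congr (_ *: _ + _ *: _); field; rewrite ?W0 ?wW0.
Qed.

Definition convex_combs A : set M := [set x |
  exists (I : finType) (w : I -> R) (p : I -> M),
    [/\ forall i, 0 <= w i, \sum_i w i = 1, forall i, A (p i)
      & x = \sum_i w i *: p i]].

Lemma conv_hullP A x : conv_hull A x <-> convex_combs A x.
Proof.
split=> [|[I [w [p [w0 w1 Ap ->]]]] C [cC AC]]; last first.
  have := @convex_comb C I (index_enum I) w p cC w0 (fun i => AC _ (Ap i)).
  by rewrite w1 invr1 scale1r; apply.
move/(_ (convex_combs A)); apply; split=> [|y Ay]; last first.
  exists unit, (fun=> 1), (fun=> y).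
  by split; rewrite ?big_const ?card_unit//= ?addr0 ?scale1r.
apply/convex_setE => _ _ t [I [w [p [w0 w1 Ap ->]]]] [J [v [q [v0 v1 Aq ->]]]].
move=> t0 t1.
exists (I + J)%type,
  (fun k => match k with inl i => t * w i | inr j => (1 - t) * v j end),
  (fun k => match k with inl i => p i | inr j => q j end).
split.
- by case=> k; rewrite mulr_ge0// subr_ge0.
- by rewrite big_sumType /= -!mulr_sumr w1 v1 !mulr1 addrC subrK.
- by case.
- rewrite big_sumType /= !scaler_sumr.
  by congr (_ + _); apply: eq_bigr => i _; rewrite scalerA.
Qed.

Lemma conv_hull_seqP (s : seq M) x : conv_hull [set` s] x <->
  exists w : 'rV[R]_(size s),
    [/\ forall i, 0 <= w 0 i, \sum_i w 0 i = 1
      & x = \sum_i w 0 i *: s`_i].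
Proof.
rewrite conv_hullP; split; last first.
  move=> [w [w0 w1 ->]].
  by exists 'I_(size s), (w 0), (fun i : 'I_(size s) => s`_i); split=> // i; apply: mem_nth.
move=> [I [w [p [w0 w1 sp ->]]]].
have ip i : (index (p i) s < size s)%N by rewrite index_mem; apply: sp.
pose f i := Ordinal (ip i).
exists (\row_j \sum_(i | f i == j) w i); split.
- by move=> j; rewrite mxE sumr_ge0.
- rewrite -w1 [RHS](partition_big f xpredT)//=.
  by apply: eq_bigr => j _; rewrite mxE.
- rewrite [LHS](partition_big f xpredT)//=; apply: eq_bigr => j _.
  rewrite mxE scaler_suml; apply: eq_bigr => i /eqP <- /=.
  by rewrite nth_index//; apply: sp.
Qed.

End ConvexHull.

Section Polytopes.
Variables (R : realType) (n : nat).
Local Notation E := 'rV[R]_n.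
Implicit Types (A B C : set E) (x y a b xi : E).

Definition dot x y : R := \sum_i x 0 i * y 0 i.

Definition minkowski_sum A B : set E := [set a + b | a in A & b in B].

Definition face xi A : set E :=
  [set x | A x /\ forall y, A y -> dot y xi <= dot x xi].

(* Polytopes are nonempty, as needed for Minkowski addition to be
   cancellative. *)
Definition is_polytope A :=
  exists V : set E, [/\ finite_set V, V !=set0 & A = conv_hull V].

Lemma dotDl x y xi : dot (x + y) xi = dot x xi + dot y xi.
Proof. by rewrite -big_split; apply: eq_bigr => i _; rewrite mxE mulrDl. Qed.

Lemma dotZl (t : R) x xi : dot (t *: x) xi = t * dot x xi.
Proof. by rewrite mulr_sumr; apply: eq_bigr => i _; rewrite mxE mulrA. Qed.

Lemma dot_suml (I : finType) (p : I -> E) xi :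
  dot (\sum_i p i) xi = \sum_i dot (p i) xi.
Proof.
rewrite /dot exchange_big; apply: eq_bigr => i _.
by rewrite summxE mulr_suml.
Qed.

Lemma minkowski_sumA A B C :
  minkowski_sum A (minkowski_sum B C) = minkowski_sum (minkowski_sum A B) C.
Proof.
apply/seteqP; split=> x.
  move=> [a Aa [_ [b Bb [c Cc <-]] <-]]; exists (a + b).
    by exists a => //; exists b.
  by exists c => //; rewrite addrA.
move=> [_ [a Aa [b Bb <-]] [c Cc <-]]; exists a => //.
by exists (b + c); [exists b => //; exists c|rewrite addrA].
Qed.

Lemma minkowski_sumC A B : minkowski_sum A B = minkowski_sum B A.
Proof.
by apply/seteqP; split=> x [a ? [b ? <-]]; exists b => //; exists a => //;
  rewrite addrC.
Qed.

Lemma minkowski_sum0 A : minkowski_sum [set 0] A = A.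
Proof.
apply/seteqP; split=> [x [_ -> [b ? <-]]|x Ax]; first by rewrite add0r.
by exists 0 => //; exists x => //; rewrite add0r.
Qed.

Lemma minkowski_sum1 x y : minkowski_sum [set x] [set y] = [set x + y].
Proof.
apply/seteqP; split=> [_ [_ -> [_ -> <-]]//|_ ->].
by exists x => //; exists y.
Qed.

Lemma conv_hull1 x : conv_hull [set x] = [set x].
Proof.
apply/seteqP; split; last exact: sub_conv_hull.
move=> y /conv_hullP[I [w [p [w0 w1 px ->]]]] /=.
rewrite (eq_bigr (fun i => w i *: x)) => [|i _]; last by rewrite (px i).
by rewrite -scaler_suml w1 scale1r.
Qed.

Lemma conv_hull_minkowski_sum A B :
  conv_hull (minkowski_sum A B) = minkowski_sum (conv_hull A) (conv_hull B).
Proof.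
apply/seteqP; split=> x.
  move=> /conv_hullP[I [w [p [w0 w1 pAB ->]]]].
  have {}pAB i : exists ab : E * E, [/\ A ab.1, B ab.2 & p i = ab.1 + ab.2].
    by have [a Aa [b Bb <-]] := pAB i; exists (a, b).
  have [f fP] := choice pAB.
  exists (\sum_i w i *: (f i).1).
    apply/conv_hullP; exists I, w, (fun i => (f i).1).
    by split=> // i; case: (fP i).
  exists (\sum_i w i *: (f i).2).
    apply/conv_hullP; exists I, w, (fun i => (f i).2).
    by split=> // i; case: (fP i).
  rewrite -big_split; apply: eq_bigr => i _ /=.
  by have [_ _ ->] := fP i; rewrite scalerDr.
move=> [_ /conv_hullP[I [w [p [w0 w1 pA ->]]]]].
move=> [_ /conv_hullP[J [v [q [v0 v1 qB ->]]]] <-].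
apply/conv_hullP.
exists (I * J)%type, (fun k => w k.1 * v k.2), (fun k => p k.1 + q k.2).
split.
- by move=> k; rewrite mulr_ge0.
- rewrite -(pair_bigA _ (fun i j => w i * v j)) /= -w1; apply: eq_bigr => i _.
  by rewrite -mulr_sumr v1 mulr1.
- by move=> k; exists (p k.1) => //; exists (q k.2).
- rewrite -(pair_bigA _ (fun i j => (w i * v j) *: (p i + q j))) /=.
  transitivity (\sum_i \sum_j (w i * v j) *: p i +
                \sum_i \sum_j (w i * v j) *: q j); last first.
    rewrite -big_split; apply: eq_bigr => i _; rewrite -big_split.
    by apply: eq_bigr => j _; rewrite scalerDr.
  congr (_ + _).
    by apply: eq_bigr => i _; rewrite -scaler_suml -mulr_sumr v1 mulr1.
  rewrite exchange_big; apply: eq_bigr => j _.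
  by rewrite -scaler_suml -mulr_suml w1 mul1r.
Qed.

Lemma conv_hull_dot_le A xi (m : R) x :
  (forall a, A a -> dot a xi <= m) -> conv_hull A x -> dot x xi <= m.
Proof.
move=> Am /conv_hullP[I [w [p [w0 w1 pA ->]]]].
rewrite dot_suml -[m]mul1r -w1 mulr_suml; apply: ler_sum => i _.
by rewrite dotZl ler_wpM2l// Am.
Qed.

Lemma face_nonempty A xi : finite_set A -> A !=set0 -> face xi A !=set0.
Proof.
move=> /finite_seqP[s ->] [a /=]; elim: s a => // b s IH a _.
case: s IH => [_|c s IH].
  by exists b; split=> [|y]; rewrite /= ?inE// => /eqP ->.
have [d [ds dmax]] := IH c (mem_head _ _).
have [db|/ltW bd] := leP (dot d xi) (dot b xi).
  exists b; split=> [|y]; rewrite /= in_cons ?eqxx// => /predU1P[->//|ys].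
  by apply: le_trans db; apply: dmax.
exists d; split=> [|y]; first by rewrite /= in_cons ds orbT.
by rewrite /= in_cons => /predU1P[->//|ys]; apply: dmax.
Qed.

Lemma face_conv_hull A xi : finite_set A -> A !=set0 ->
  face xi (conv_hull A) = conv_hull (face xi A).
Proof.
move=> finA A0; have [a [Aa amax]] := face_nonempty xi finA A0.
apply/seteqP; split=> x.
  move=> [/conv_hullP[I [w [p [w0 w1 pA xE]]]] xmax].
  have /xmax ax : conv_hull A a by exact: sub_conv_hull.
  have wp i : w i * (dot a xi - dot (p i) xi) = 0.
    have ge i' : 0 <= w i' * (dot a xi - dot (p i') xi).
      by rewrite mulr_ge0// subr_ge0; apply: amax.
    have : \sum_i w i * (dot a xi - dot (p i) xi) <= 0.
      rewrite (eq_bigr (fun i => w i * dot a xi - dot (w i *: p i) xi)).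
        by rewrite big_split /= sumrN -mulr_suml w1 mul1r -dot_suml -xE subr_le0.
      by move=> j _; rewrite dotZl mulrBr.
    rewrite le_eqVlt ltNge sumr_ge0// orbF psumr_eq0//.
    by move=> /allP/(_ i (mem_index_enum _))/eqP.
  apply/conv_hullP; exists I, w, (fun i => if w i == 0 then a else p i).
  split=> //; last first.
    by rewrite xE; apply: eq_bigr => i _; case: eqP => // ->; rewrite !scale0r.
  move=> i; case: eqVneq => [_|wi]; first by split.
  have /eqP := wp i; rewrite mulf_eq0 (negbTE wi) subr_eq0 => /eqP ap.
  by split=> // y Ay; rewrite -ap; apply: amax.
have leF b : conv_hull A b -> dot b xi <= dot a xi.
  by apply: conv_hull_dot_le.
move=> xF; have xA : conv_hull A x.
  by move=> C [cC AC]; apply: xF; split=> // b [/AC].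
split=> // b /leF /le_trans; apply; rewrite -lerN2.
have dotN c : - dot c xi = dot c (- xi).
  by rewrite /dot -sumrN; apply: eq_bigr => i _; rewrite mxE mulrN.
rewrite !dotN; apply: conv_hull_dot_le xF => b' [Ab' /(_ _ Aa)].
by rewrite -!dotN lerN2.
Qed.

Lemma face_minkowski_sum A B xi :
  face xi (minkowski_sum A B) = minkowski_sum (face xi A) (face xi B).
Proof.
apply/seteqP; split=> x.
  move=> [[a Aa [b Bb <-]] xmax]; exists a; last exists b => //.
    split=> // a' Aa'; have := xmax (a' + b).
    by rewrite !dotDl lerD2r; apply; exists a' => //; exists b.
  split=> // b' Bb'; have := xmax (a + b').
  by rewrite !dotDl lerD2l; apply; exists a => //; exists b'.
move=> [a [Aa amax] [b [Bb bmax] <-]]; split; first by exists a => //; exists b.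
by move=> _ [a' Aa' [b' Bb' <-]]; rewrite !dotDl lerD//; [apply: amax|apply: bmax].
Qed.

Lemma face1 x xi : face xi [set x] = [set x].
Proof. by apply/seteqP; split=> [y []//|_ ->]; split=> // y ->. Qed.

Lemma is_polytope_hull A : finite_set A -> A !=set0 -> is_polytope (conv_hull A).
Proof. by move=> finA A0; exists A. Qed.

Lemma is_polytope1 x : is_polytope [set x].
Proof. by exists [set x]; rewrite conv_hull1; split=> //; exists x. Qed.

Lemma is_polytopeD A B :
  is_polytope A -> is_polytope B -> is_polytope (minkowski_sum A B).
Proof.
move=> [V [finV [v Vv] ->]] [W [finW [w Ww] ->]]; exists (minkowski_sum V W); split.
- exact: finite_image2.
- by exists (v + w), v => //; exists w.
- by rewrite conv_hull_minkowski_sum.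
Qed.

Lemma is_polytope_face A xi : is_polytope A -> is_polytope (face xi A).
Proof.
move=> [V [finV V0 ->]]; rewrite face_conv_hull//; exists (face xi V); split=> //.
  by apply: sub_finite_set finV => x [].
exact: face_nonempty.
Qed.

Definition normsq x : R := \sum_i x 0 i ^+ 2.

Definition simplex m : set 'rV[R]_m :=
  [set w | forall i, 0 <= w 0 i] `&` [set w | \sum_i w 0 i = 1].

Lemma continuous_bigsum (T : topologicalType) (I : Type) (r : seq I)
  (F : I -> T -> R) : (forall i, continuous (F i)) ->
  continuous (fun z : T => \sum_(i <- r) F i z).
Proof.
move=> cF; elim: r => [|i r IH] z0.
  rewrite (_ : (fun _ => _) = cst 0); first exact: cst_continuous.
  by apply/funext => y; rewrite big_nil.
rewrite (_ : (fun _ => _) = F i \+ (fun z => \sum_(i <- r) F i z)).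
  by apply: continuousD; [exact: cF|exact: IH].
by apply/funext => y; rewrite big_cons.
Qed.

Lemma compact_simplex m : compact (@simplex m).
Proof.
rewrite (_ : @simplex m =
   [set w : 'rV[R]_m | forall i, `[0, 1]%classic (w 0 i)] `&`
   ((fun w : 'rV[R]_m => \sum_i w 0 i) @^-1` [set 1])).
  apply: compact_closedI.
    apply: (@rV_compact R m (fun=> `[0, 1]%classic)) => _.
    exact: segment_compact.
  apply: (continuous_closedP _).1; last exact: closed_eq.
  by apply: continuous_bigsum => i; exact: coord_continuous.
apply/seteqP; split=> w [w0 w1]; split=> // i.
  rewrite /= in_itv /= w0 /= -w1 (bigD1 i)//= lerDl sumr_ge0//.
by have := w0 i; rewrite /= in_itv => /andP[].
Qed.

Lemma polytope_EVT A a : is_polytope A ->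
  (exists2 b, A b & forall x, A x -> normsq (b - a) <= normsq (x - a)) /\
  (exists M, forall x, A x -> normsq (x - a) <= M).
Proof.
move=> [V [/finite_seqP[s ->] [v sv] ->]].
pose pt (w : 'rV[R]_(size s)) := \sum_i w 0 i *: s`_i.
pose f w := normsq (pt w - a).
have ptP w : simplex w -> conv_hull [set` s] (pt w).
  by move=> [w0 w1]; apply/conv_hull_seqP; exists w.
have cf : continuous f.
  apply: continuous_bigsum => i w; rewrite /pt.
  rewrite (_ : (fun _ => _) = (fun w : 'rV[R]_(size s) =>
     (\sum_j w 0 j * s`_j 0 i - a 0 i) * (\sum_j w 0 j * s`_j 0 i - a 0 i))).
    have c : continuous (fun w : 'rV[R]_(size s) =>
        \sum_j w 0 j * s`_j 0 i - a 0 i).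
      move=> u; apply: continuousB; last exact: cst_continuous.
      apply: continuous_bigsum => j z; apply: continuousM; last exact: cst_continuous.
      exact: coord_continuous.
    exact: (@continuousM _ _ _ _ w (c w) (c w)).
  apply/funext => u; rewrite expr2 !mxE summxE.
  by under eq_bigr do rewrite mxE.
have [w0 [w0P w0E]] : exists w, simplex w /\ v = pt w.
  have /conv_hull_seqP[w [w0 w1 ->]] : conv_hull [set` s] v.
    exact: sub_conv_hull.
  by exists w.
have sne : @simplex (size s) !=set0 by exists w0.
have wcf : {within @simplex (size s), continuous f}.
  exact: continuous_subspaceT.
split.
  have [c /set_mem cP cmin] :=
    compact_EVT_min sne (@compact_simplex (size s)) wcf.
  exists (pt c); first exact: ptP.
  move=> x /conv_hull_seqP[w [wp w1 ->]]; apply: cmin.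
  by apply/mem_set.
have [c /set_mem cP cmax] :=
  compact_EVT_max sne (@compact_simplex (size s)) wcf.
exists (f c) => x /conv_hull_seqP[w [wp w1 ->]]; apply: cmax.
by apply/mem_set.
Qed.

Lemma polytope_convex A x y (t : R) : is_polytope A -> A x -> A y ->
  0 <= t -> t <= 1 -> A (t *: x + (1 - t) *: y).
Proof. by move=> [V [_ _ ->]]; exact: conv_hull_convex. Qed.

Lemma minkowski_sum_cancel_sub A B C :
  is_polytope B -> is_polytope C ->
  minkowski_sum A C `<=` minkowski_sum B C -> A `<=` B.
Proof.
move=> pB pC AC a Aa.
have [c0 Cc0] : C !=set0.
  by move: pC => [V [_ [v Vv] ->]]; exists v; apply: sub_conv_hull.
have step c : C c -> exists b c', [/\ B b, C c' & a + c = b + c'].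
  move=> Cc; have [|b Bb [c' Cc' e]] := AC (a + c).
    by exists a => //; exists c.
  by exists b, c'.
have iterate k : exists b c, [/\ B b, C c & k.+1%:R *: (b - a) = c0 - c].
  elim: k => [|k [b [c [Bb Cc e]]]].
    have [b [c [Bb Cc e]]] := step c0 Cc0; exists b, c; split=> //.
    rewrite scale1r; apply/eqP.
    by rewrite subr_eq addrAC [c0 + a]addrC e addrK.
  have [b' [c' [Bb' Cc' e']]] := step c Cc.
  pose t : R := k.+1%:R / k.+2%:R.
  have k2 : k.+2%:R != 0 :> R by rewrite pnatr_eq0.
  exists (t *: b + (1 - t) *: b'), c'; split=> //.
    apply: polytope_convex => //; first by rewrite divr_ge0.
    by rewrite ler_pdivrMr ?ltr0n// mul1r ler_nat.
  have -> : c0 - c' = (c0 - c) + (c - c') by rewrite addrA subrK.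
  have -> : c - c' = b' - a.
    by apply/eqP; rewrite subr_eq addrAC -e' addrAC subrr add0r.
  rewrite -e; apply/rowP => i; rewrite !mxE /t -[k.+2]addn1 natrD.
  by field; rewrite nat1r natr1.
have [[b Bb bmin] _] := polytope_EVT a pB.
have [_ [M CM]] := polytope_EVT c0 pC.
have normsq_ge0 x : 0 <= normsq x by apply: sumr_ge0 => i _; exact: sqr_ge0.
have normsqZ (t : R) x : normsq (t *: x) = t ^+ 2 * normsq x.
  by rewrite mulr_sumr; apply: eq_bigr => i _; rewrite mxE exprMn.
have bound k : k.+1%:R * normsq (b - a) <= M.
  have [b' [c [Bb' Cc e]]] := iterate k.
  apply: le_trans (CM c Cc).
  rewrite -[c - c0]opprB -e -scaleNr normsqZ sqrrN.
  apply: ler_pM => //; last exact: bmin.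
  by rewrite expr2 ler_peMl// ler1n.
have : normsq (b - a) = 0.
  apply/eqP; rewrite eq_le normsq_ge0 andbT leNgt; apply/negP => d0.
  have := archi_boundP (divr_ge0 (le_trans (normsq_ge0 _) (CM _ Cc0)) (ltW d0)).
  rewrite ltr_pdivrMr// ltNge => /negP; apply.
  apply: le_trans (bound (Num.bound (M / normsq (b - a)))).
  by rewrite ler_pM2r// ler_nat.
move=> /eqP; rewrite psumr_eq0 => [/allP ba0|i _]; last exact: sqr_ge0.
suff -> : a = b by [].
apply/rowP => i; have := ba0 i (mem_index_enum _).
by rewrite /= sqrf_eq0 !mxE subr_eq0 => /eqP.
Qed.

Lemma minkowski_sum_cancel A B C :
  is_polytope A -> is_polytope B -> is_polytope C ->
  minkowski_sum A C = minkowski_sum B C -> A = B.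
Proof.
move=> pA pB pC e; apply/seteqP; split.
  by apply: minkowski_sum_cancel_sub pB pC _; rewrite e.
by apply: minkowski_sum_cancel_sub pA pC _; rewrite e.
Qed.

End Polytopes.

Record polytope (R : realType) (n : nat) := Polytope {
  polytope_set :> set 'rV[R]_n;
  polytopeP : is_polytope polytope_set
}.

HB.instance Definition _ (R : realType) (n : nat) := gen_eqMixin (polytope R n).
HB.instance Definition _ (R : realType) (n : nat) :=
  gen_choiceMixin (polytope R n).

Section PolytopeSemigroup.
Variables (R : realType) (n : nat).
Implicit Types (K L P : polytope R n) (x xi : 'rV[R]_n).

Lemma polytope_inj K L : K = L :> set 'rV[R]_n -> K = L.
Proof.
by case: K L => [A pA] [B pB] /= e; subst B; congr Polytope.
Qed.

Definition polytope_add K L : polytope R n :=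
  Polytope (is_polytopeD (polytopeP K) (polytopeP L)).

Definition point x : polytope R n := Polytope (is_polytope1 x).

Definition polytope_face xi K : polytope R n :=
  Polytope (is_polytope_face xi (polytopeP K)).

Lemma polytope_addA : associative polytope_add.
Proof. by move=> K L P; apply/polytope_inj/minkowski_sumA. Qed.

Lemma polytope_addC : commutative polytope_add.
Proof. by move=> K L; apply/polytope_inj/minkowski_sumC. Qed.

Lemma polytope_add0 : left_id (point 0) polytope_add.
Proof. by move=> K; apply/polytope_inj/minkowski_sum0. Qed.

HB.instance Definition _ := GRing.isNmodule.Build (polytope R n)
  polytope_addA polytope_addC polytope_add0.

Lemma polytope_addI : right_injective (@GRing.add (polytope R n)).
Proof.
move=> P K L; rewrite ![P + _]addrC => e; apply/polytope_inj.
apply: (minkowski_sum_cancel (polytopeP K) (polytopeP L) (polytopeP P)).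
by have := congr1 (@polytope_set R n) e.
Qed.

Lemma pointD x y : point (x + y) = point x + point y.
Proof. by apply/polytope_inj; rewrite /= minkowski_sum1. Qed.

Lemma polytope_faceD xi K L :
  polytope_face xi (K + L) = polytope_face xi K + polytope_face xi L.
Proof. exact/polytope_inj/face_minkowski_sum. Qed.

Lemma polytope_face_point xi x : polytope_face xi (point x) = point x.
Proof. exact/polytope_inj/face1. Qed.

End PolytopeSemigroup.

Section VirtualPolytopes.
Variables (R : realType) (n : nat).
Implicit Types (K L P : polytope R n) (x xi : 'rV[R]_n).

(* The pair (L, M) stands for the formal difference L - M. *)
Definition virtual_eq (p q : polytope R n * polytope R n) :=
  p.1 + q.2 == q.1 + p.2.

Lemma virtual_eq_refl : reflexive virtual_eq.
Proof. by move=> p; rewrite /virtual_eq. Qed.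

Lemma virtual_eq_sym : symmetric virtual_eq.
Proof. by move=> p q; rewrite /virtual_eq eq_sym. Qed.

Lemma virtual_eq_trans : transitive virtual_eq.
Proof.
move=> q p r /eqP pq /eqP qr; apply/eqP/(@polytope_addI _ _ q.2).
by rewrite addrCA addrA pq addrAC qr -addrA addrCA.
Qed.

Canonical virtual_eq_equiv :=
  EquivRel virtual_eq virtual_eq_refl virtual_eq_sym virtual_eq_trans.

Definition virtual_polytope := {eq_quot virtual_eq}.

HB.instance Definition _ : EqQuotient _ virtual_eq virtual_polytope :=
  EqQuotient.on virtual_polytope.
HB.instance Definition _ := Choice.on virtual_polytope.

Definition formal_diff L M : virtual_polytope := \pi_virtual_polytope (L, M).

Lemma formal_diffP L1 M1 L2 M2 :
  formal_diff L1 M1 = formal_diff L2 M2 <-> L1 + M2 = L2 + M1.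
Proof. by split=> [/eqmodP/eqP|/eqP e]; [|apply/eqmodP]. Qed.

Lemma formal_diffW (T : virtual_polytope -> Prop) :
  (forall L M, T (formal_diff L M)) -> forall V, T V.
Proof. by move=> LM V; rewrite -[V]reprK; case: (repr V) => L M; exact: LM. Qed.

Definition virtual_add (U V : virtual_polytope) : virtual_polytope :=
  formal_diff ((repr U).1 + (repr V).1) ((repr U).2 + (repr V).2).

Definition virtual_opp (V : virtual_polytope) : virtual_polytope :=
  formal_diff (repr V).2 (repr V).1.

(* Written on representatives; [virtual_face_diff] below shows that it does not
   depend on them. *)
Definition virtual_face xi (V : virtual_polytope) : virtual_polytope :=
  formal_diff (polytope_face xi (repr V).1) (polytope_face xi (repr V).2).

Lemma repr_formal_diff L M :
  (repr (formal_diff L M)).1 + M = L + (repr (formal_diff L M)).2.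
Proof.
by apply/formal_diffP; rewrite /formal_diff -surjective_pairing reprK.
Qed.

Lemma virtual_add_diff L1 M1 L2 M2 :
  virtual_add (formal_diff L1 M1) (formal_diff L2 M2) =
  formal_diff (L1 + L2) (M1 + M2).
Proof. by apply/formal_diffP; rewrite addrACA !repr_formal_diff addrACA. Qed.

Lemma virtual_opp_diff L M : virtual_opp (formal_diff L M) = formal_diff M L.
Proof.
by apply/formal_diffP; rewrite addrC -repr_formal_diff addrC.
Qed.

Lemma virtual_face_diff xi L M : virtual_face xi (formal_diff L M) =
  formal_diff (polytope_face xi L) (polytope_face xi M).
Proof. by apply/formal_diffP; rewrite -!polytope_faceD repr_formal_diff. Qed.

Lemma virtual_addA : associative virtual_add.
Proof.
elim/formal_diffW=> L1 M1; elim/formal_diffW=> L2 M2; elim/formal_diffW=> L3 M3.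
by rewrite !virtual_add_diff !addrA.
Qed.

Lemma virtual_addC : commutative virtual_add.
Proof.
elim/formal_diffW=> L1 M1; elim/formal_diffW=> L2 M2.
by rewrite !virtual_add_diff [L1 + _]addrC [M1 + _]addrC.
Qed.

Lemma virtual_add0 : left_id (formal_diff 0 0) virtual_add.
Proof. by elim/formal_diffW=> L M; rewrite virtual_add_diff !add0r. Qed.

Lemma virtual_addN : left_inverse (formal_diff 0 0) virtual_opp virtual_add.
Proof.
elim/formal_diffW=> L M; rewrite virtual_opp_diff virtual_add_diff.
by apply/formal_diffP; rewrite addr0 add0r addrC.
Qed.

HB.instance Definition _ := GRing.isZmodule.Build virtual_polytope
  virtual_addA virtual_addC virtual_add0 virtual_addN.

Definition virtual K : virtual_polytope := formal_diff K 0.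

Lemma virtualD K L : virtual (K + L) = virtual K + virtual L.
Proof. by rewrite [RHS]virtual_add_diff addr0. Qed.

Lemma formal_diffE L M : formal_diff L M = virtual L - virtual M.
Proof.
by rewrite /GRing.opp/= /GRing.add/= virtual_opp_diff virtual_add_diff addr0 add0r.
Qed.

Lemma virtual_inj : injective virtual.
Proof. by move=> K L /formal_diffP; rewrite !addr0. Qed.

(* A point v is identified with the virtual polytope {v}. *)
Definition vert (V : virtual_polytope) : set 'rV[R]_n :=
  [set v | exists xi, virtual_face xi V = virtual (point v)].

Lemma virtual_pointB x y :
  virtual (point x) - virtual (point y) = virtual (point (x - y)).
Proof. by apply/eqP; rewrite subr_eq -virtualD -pointD subrK. Qed.

Lemma vert_virtual K :
  vert (virtual K) = [set v | exists xi, face xi K = [set v]].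
Proof.
apply/seteqP; split=> v [xi e]; exists xi.
  move: e; rewrite virtual_face_diff => /formal_diffP.
  rewrite polytope_face_point !addr0 => /(congr1 (@polytope_set R n)).
  exact.
by rewrite virtual_face_diff polytope_face_point; congr formal_diff;
  apply/polytope_inj.
Qed.

End VirtualPolytopes.

Section Cyclopermutohedron.
Variables (R : realType) (n : nat).
Implicit Types a b : 'rV[R]_n.

Lemma segment_subproof a b : is_polytope (conv_hull [set a; b]).
Proof. by apply: is_polytope_hull; [exact: finite_set2|exists a; left]. Qed.

Definition segment a b : polytope R n := Polytope (segment_subproof a b).

(* Coordinates are indexed from 0, so permuting (1, ..., n) by s puts s i + 1
   in position i. *)
Definition perm_point (s : 'S_n) : 'rV[R]_n := \row_i (s i).+1%:R.

Lemma permutohedron_subproof : is_polytope (conv_hull (range perm_point)).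
Proof.
apply: is_polytope_hull; first exact/finite_image/finite_finset.
by exists (perm_point 1%g); exists 1%g.
Qed.

Definition permutohedron : polytope R n := Polytope permutohedron_subproof.

Definition basis_vec (i : 'I_n) : 'rV[R]_n := delta_mx 0 i.

Definition vecS : 'rV[R]_n := const_mx 1.

Definition vecR (i : 'I_n) : 'rV[R]_n := \sum_j (basis_vec i - basis_vec j).

(* For vectors of length n this is the cyclopermutohedron CP_(n+1). *)
Definition cyclopermutohedron : virtual_polytope R n :=
  \sum_(i < n) \sum_(j < n | (i < j)%N) virtual (segment (basis_vec i) (basis_vec j))
  + virtual (point vecS) - \sum_(i < n) virtual (segment 0 (vecR i)).

End Cyclopermutohedron.

(* Main.v *)
Require Import Defs.
From mathcomp Require Import all_boot all_order all_algebra.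
From mathcomp Require Import all_classical all_reals all_analysis.
From mathcomp Require Import perm ring zify.

Import Order.TTheory GRing.Theory Num.Theory.

Set Implicit Arguments.
Unset Strict Implicit.
Unset Printing Implicit Defensive.

Local Open Scope classical_set_scope.
Local Open Scope ring_scope.

(** The face of a Minkowski sum in a direction xi is the sum of the faces of the
summands, and the face of a segment is an endpoint, or the whole segment when
xi is orthogonal to it. So the face of the cyclopermutohedron in the direction
xi is a point as soon as xi is [generic]: its coordinates are distinct and none
of them equals their mean, which says that xi is orthogonal to no e_i - e_j and
to no R_i.

Conversely a face that is a point comes from a generic xi ([vertex_generic]).
Being virtual, the polytope could a priori have segments q_ij and r_i that
cancel in a face. They do not: the face equation is an equality between honest
Minkowski sums, and it survives taking a second face. For n >= 3 the direction
eta = e_i + e_j is orthogonal to e_i - e_j but to no R_k, so if xi_i = xi_j the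
face in the direction eta makes the side of the r_k a point, while the other
side keeps the summand [e_i, e_j]. Hence the xi_i are distinct, one side is
then a point, and no r_k can survive on the other.

For a generic xi, let rho_k be the number of coordinates of xi below xi_k and
A the set of coordinates above the mean. The q_ij and S contribute rho_k + 1 to
the k-th coordinate, and since R_i = n e_i - S, subtracting the R_i with i in A
adds #|A| - n [k in A] ([virtual_face_generic]). As A consists of the #|A|
largest coordinates, the result is (rho_k + #|A|) mod n, plus 1: a cyclic shift
of a permutation, hence a vertex of the permutohedron
([cyclo_vertex_perm_point]). Every permutation arises, already with A a
singleton ([perm_point_cyclo_vertex]). The vertices of the permutohedron are
all the permutations of (1, ..., n), because these lie on a common sphere
([vert_permutohedron]). *)

Local Notation point := Defs.point.

(** * Faces of sums and of segments *)

Section Points.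
Variables (R : realType) (n : nat).
Implicit Types (K L : polytope R n) (x xi a b v : 'rV[R]_n).

Definition is_point K := exists x, K = point x.

Lemma point_inj : injective (@point R n).
Proof.
move=> x y /(congr1 (@polytope_set R n)) /= e.
have : [set y] x by rewrite -e.
by [].
Qed.

(** Minkowski addition cannot shrink a summand: a translate of K sits inside
K + L. *)
Lemma is_point_addl K L : is_point (K + L) -> is_point K.
Proof.
move=> [v /(congr1 (@polytope_set R n)) KLv].
have {}KLv : minkowski_sum K L = [set v] := KLv.
have [a [Ka [b [Lb _]]]] : exists a, polytope_set K a /\
    exists b, polytope_set L b /\ a + b = v.
  have [a Ka [b Lb ab]] : minkowski_sum K L v by rewrite KLv.
  by exists a; split=> //; exists b.
have sumE x : polytope_set K x -> x + b = v.
  by move=> Kx; have : [set v] (x + b) by rewrite -KLv; exists x => //; exists b.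
exists a; apply/polytope_inj/seteqP; split=> [x Kx|_ ->//].
by apply: (addIr b); rewrite !sumE.
Qed.

Lemma is_point_summand (I : finType) (P : pred I) (K : I -> polytope R n) i :
  P i -> is_point (\sum_(j | P j) K j) -> is_point (K i).
Proof. by move=> Pi; rewrite (bigD1 i)//=; exact: is_point_addl. Qed.

Lemma point_sum (I : Type) (r : seq I) (P : pred I) (x : I -> 'rV[R]_n) :
  \sum_(i <- r | P i) point (x i) = point (\sum_(i <- r | P i) x i).
Proof. by symmetry; apply: big_morph => //; exact: pointD. Qed.

Lemma is_point_sum (I : Type) (r : seq I) (P : pred I) (K : I -> polytope R n) :
  (forall i, P i -> is_point (K i)) -> is_point (\sum_(i <- r | P i) K i).
Proof.
move=> PK; elim/big_ind: _ => //; first by exists 0.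
by move=> _ _ [x ->] [y ->]; exists (x + y); rewrite pointD.
Qed.

Lemma polytope_face_sum xi (I : Type) (r : seq I) (P : pred I)
    (K : I -> polytope R n) :
  polytope_face xi (\sum_(i <- r | P i) K i) =
  \sum_(i <- r | P i) polytope_face xi (K i).
Proof.
apply: big_morph; first exact: polytope_faceD.
exact: polytope_face_point.
Qed.

Lemma virtual_sum (I : Type) (r : seq I) (P : pred I) (K : I -> polytope R n) :
  virtual (\sum_(i <- r | P i) K i) = \sum_(i <- r | P i) virtual (K i).
Proof. by apply: big_morph => //; exact: virtualD. Qed.

Lemma dot0 xi : dot 0 xi = 0.
Proof. by rewrite -(scale0r 0) dotZl mul0r. Qed.

Lemma segmentC a b : segment a b = segment b a.
Proof. by apply: polytope_inj; rewrite /= setUC. Qed.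

Lemma is_point_segment a b : is_point (segment a b) -> a = b.
Proof.
move=> [x /(congr1 (@polytope_set R n)) /= abx].
have /= -> : [set x] a by rewrite -abx; apply: sub_conv_hull; left.
by have /= -> : [set x] b by rewrite -abx; apply: sub_conv_hull; right.
Qed.

Lemma segment_face_lt xi a b :
  dot b xi < dot a xi -> polytope_face xi (segment a b) = point a.
Proof.
move=> ba; apply: polytope_inj => /=.
rewrite face_conv_hull; [|exact: finite_set2|by exists a; left].
rewrite [X in conv_hull X](_ : _ = [set a]) ?conv_hull1//.
apply/seteqP; split=> [x [[->//|->] /(_ a)]|_ ->] /=.
  by move=> /(_ (or_introl erefl)); rewrite leNgt ba.
by split=> [|y [->//|->]]; [left|exact: ltW].
Qed.

Lemma segment_face_gt xi a b :
  dot a xi < dot b xi -> polytope_face xi (segment a b) = point b.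
Proof. by rewrite segmentC; exact: segment_face_lt. Qed.

Lemma segment_face_eq xi a b :
  dot a xi = dot b xi -> polytope_face xi (segment a b) = segment a b.
Proof.
move=> ab; apply: polytope_inj => /=.
rewrite face_conv_hull; [|exact: finite_set2|by exists a; left].
congr conv_hull; apply/seteqP; split=> [x []//|x abx]; split=> // y.
by case: abx => ->; case=> ->; rewrite ?ab.
Qed.

End Points.

(** * Vertices of the permutohedron *)

Section Permutohedron.
Variables (R : realType) (n : nat).
Implicit Types (x y xi : 'rV[R]_n) (s t : 'S_n).

Lemma normsqB x y : normsq (x - y) = normsq x + normsq y - dot y x *+ 2.
Proof.
rewrite /normsq /dot -sumrMnl -sumrN -!big_split; apply: eq_bigr => i _ /=.
by rewrite !mxE sqrrB addrAC mulrC.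
Qed.

Lemma normsq_perm_point s t :
  normsq (perm_point R s) = normsq (perm_point R t).
Proof.
have normsqE (u : 'S_n) : normsq (perm_point R u) = \sum_(i < n) i.+1%:R ^+ 2.
  rewrite [RHS](reindex_inj (@perm_inj _ u)).
  by apply: eq_bigr => i _; rewrite mxE.
by rewrite !normsqE.
Qed.

(** A perm_point p is exposed by the direction p itself: all perm_points have the
same norm, so |p - q|^2 >= 0 reads (q, p) <= (p, p), with equality only for
q = p. *)
Lemma vert_permutohedron :
  vert (virtual (permutohedron R n)) = range (@perm_point R n).
Proof.
have finV : finite_set (range (@perm_point R n)).
  exact/finite_image/finite_finset.
have V0 : range (@perm_point R n) !=set0 by exists (perm_point R (1%g : 'S_n)), 1%g.
rewrite vert_virtual; apply/seteqP; split=> [v [xi]|_ [s _ <-]].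
  (* A face of a hull is the hull of the generators it contains. *)
  rewrite /= face_conv_hull// => ev.
  have [w wF] := face_nonempty xi finV V0.
  have /= <- : [set v] w by rewrite -ev; exact: sub_conv_hull.
  by case: wF.
exists (perm_point R s); rewrite /= face_conv_hull// -[RHS]conv_hull1.
set p := perm_point R s.
have dpp : dot p p = normsq p by apply: eq_bigr => i _; rewrite expr2.
have nsq0 x : 0 <= normsq x by apply: sumr_ge0 => i _; exact: sqr_ge0.
congr conv_hull; apply/seteqP; split=> [_ [[t _ <-] /(_ p)]|_ ->].
  set q := perm_point R t => qmax.
  have {}qmax : dot p p <= dot q p by apply: qmax; exists s.
  have : normsq (p - q) = 0.
    apply/eqP; rewrite eq_le nsq0 andbT normsqB (normsq_perm_point t s) -/p.
    by rewrite subr_le0 -mulr2n lerMn2r -dpp qmax orbT.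
  move=> /eqP; rewrite psumr_eq0 => [/allP pq|i _]; last exact: sqr_ge0.
  apply/rowP => i; have := pq i (mem_index_enum _).
  by rewrite /= sqrf_eq0 !mxE subr_eq0 => /eqP.
split=> [|_ [t _ <-]]; first by exists s.
have := nsq0 (p - perm_point R t).
by rewrite normsqB (normsq_perm_point t s) -/p -mulr2n subr_ge0 lerMn2r dpp.
Qed.

End Permutohedron.

Local Close Scope classical_set_scope.
Local Open Scope set_scope.
Local Open Scope ring_scope.

(** * Vertices of the cyclopermutohedron *)

Section Cyclopermutohedron.
Variables (R : realType) (n : nat).
Implicit Types (xi eta v : 'rV[R]_n) (i j k : 'I_n) (s : 'S_n).

Local Notation basis_vec := (@basis_vec R n).
Local Notation vecR := (@vecR R n).
Local Notation vecS := (@vecS R n).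

Lemma dot_basis_vec i xi : dot (basis_vec i) xi = xi 0 i.
Proof.
rewrite /dot (bigD1 i)//= big1 => [|j ji]; rewrite !mxE eqxx /= ?eqxx ?mul1r ?addr0//.
by rewrite (negbTE ji) mul0r.
Qed.

Lemma basis_vec_inj : injective basis_vec.
Proof.
move=> i j /rowP/(_ i); rewrite !mxE !eqxx /=.
by case: eqVneq => // _ /eqP; rewrite oner_eq0.
Qed.

Lemma sum_basis_vec i : \sum_l basis_vec i 0 l = 1.
Proof.
rewrite (bigD1 i)//= big1 => [|l li]; rewrite !mxE !eqxx ?addr0//=.
by rewrite (negbTE li).
Qed.

Lemma basis_vec_comb (c : 'I_n -> nat) k :
  (\sum_i basis_vec i *+ c i) 0 k = (c k)%:R.
Proof.
rewrite summxE (bigD1 k)//= big1 => [|l lk]; rewrite mulmxnE mxE eqxx /= ?eqxx ?addr0//.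
by rewrite eq_sym (negbTE lk) mul0rn.
Qed.

Lemma dot_vecR i xi : dot (vecR i) xi = xi 0 i *+ n - \sum_j xi 0 j.
Proof.
rewrite dot_suml -[X in _ *+ X]card_ord -sumr_const -sumrB.
apply: eq_bigr => j _.
by rewrite dotDl -scaleN1r dotZl !dot_basis_vec mulN1r.
Qed.

Lemma vecRE i : vecR i = basis_vec i *+ n - vecS.
Proof.
rewrite /Defs.vecR sumrB sumr_const card_ord; congr (_ - _).
apply/rowP => k; rewrite summxE mxE (bigD1 k)//= big1 => [|j jk].
  by rewrite !mxE !eqxx addr0.
by rewrite !mxE eq_sym (negbTE jk) andbF.
Qed.

(** The directions orthogonal to no edge e_i - e_j and to no R_i. *)
Definition generic xi := (forall i j, xi 0 i = xi 0 j -> i = j) /\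
  (forall i, xi 0 i *+ n != \sum_j xi 0 j).

Definition rank xi k := #|[set j | xi 0 j < xi 0 k]|.

(** The indices i with (R_i, xi) > 0, see [dot_vecR]. *)
Definition above_mean xi := [set i | \sum_j xi 0 j < xi 0 i *+ n].

(** Clearing the formal difference turns a statement on virtual polytopes into
an equality of Minkowski sums. *)
Lemma virtual_face_cyclopermutohedron xi v :
  virtual_face xi (cyclopermutohedron R n) = virtual (point v) <->
  \sum_(i < n) \sum_(j < n | (i < j)%N)
     polytope_face xi (segment (basis_vec i) (basis_vec j)) + point vecS =
  point v + \sum_(i < n) polytope_face xi (segment 0 (vecR i)).
Proof.
rewrite /cyclopermutohedron.
under eq_bigr do rewrite -virtual_sum.
rewrite -!virtual_sum -virtualD -formal_diffE virtual_face_diff formal_diffP.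
rewrite addr0 polytope_faceD polytope_face_point !polytope_face_sum.
by under eq_bigr do rewrite polytope_face_sum.
Qed.

Lemma vecR_face_point xi i : dot (vecR i) xi != 0 ->
  polytope_face xi (segment 0 (vecR i)) =
  point (if i \in above_mean xi then vecR i else 0).
Proof.
rewrite inE -subr_gt0 -dot_vecR.
case: (ltgtP (dot (vecR i) xi) 0) => // d _.
  by rewrite segment_face_lt ?dot0.
by rewrite segment_face_gt ?dot0.
Qed.

(** Opposite summands cannot cancel: a tie xi_i = xi_j is detected by the face in
the direction e_i + e_j, orthogonal to q_ij but, as n >= 3, to no r_k; without
ties all the q_ij contribute points, which forces the r_k to do so too. *)
Lemma vertex_generic xi v : (2 < n)%N ->
  virtual_face xi (cyclopermutohedron R n) = virtual (point v) -> generic xi.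
Proof.
move=> n_gt2 /virtual_face_cyclopermutohedron faceE.
have pairs_distinct i j : (i < j)%N -> xi 0 i != xi 0 j.
  move=> ij; apply/eqP => xiij.
  pose eta : 'rV[R]_n := basis_vec i + basis_vec j.
  have etaij : eta 0 i = eta 0 j.
    by rewrite !mxE !eqxx /= [in RHS]addrC [i == j]eq_sym.
  have vecR_eta k : dot (vecR k) eta != 0.
    have sum_eta : \sum_l eta 0 l = 2%:R.
      by under eq_bigr do rewrite mxE; rewrite big_split /= !sum_basis_vec.
    (* n * eta_k is 0 or n, never the coordinate sum 2. *)
    rewrite dot_vecR sum_eta subr_eq0 !mxE eqxx /= -!natrD -mulrnA eqr_nat.
    have : ~~ ((k == i) && (k == j)).
      by apply/negP => /andP[/eqP ki /eqP kj]; rewrite -ki -kj ltnn in ij.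
    by case: (k == i); case: (k == j) => //= _; lia.
  have : is_point (\sum_(i < n) \sum_(j < n | (i < j)%N)
     polytope_face eta (polytope_face xi (segment (basis_vec i) (basis_vec j)))
     + point vecS).
    have := congr1 (polytope_face eta) faceE.
    rewrite !polytope_faceD !polytope_face_point !polytope_face_sum.
    under eq_bigr do rewrite polytope_face_sum.
    move=> ->.
    suff [x ->] : is_point (\sum_(k < n)
        polytope_face eta (polytope_face xi (segment 0 (vecR k)))).
      by exists (v + x); rewrite pointD.
    apply: is_point_sum => k _.
    have [d0|d0] := eqVneq (dot (vecR k) xi) 0.
      rewrite (segment_face_eq (xi := xi)) ?dot0// vecR_face_point//.
      by eexists.
    by rewrite vecR_face_point// polytope_face_point; eexists.
  move=> /is_point_addl /(is_point_summand (i := i) isT).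
  move=> /(is_point_summand (i := j) ij).
  rewrite !segment_face_eq ?dot_basis_vec// => /is_point_segment.
  by move=> /basis_vec_inj eij; rewrite eij ltnn in ij.
split=> [i j xiij|i].
  apply: val_inj; case: (ltngtP i j) => // /pairs_distinct.
    by rewrite xiij eqxx.
  by rewrite xiij eqxx.
(* With no tie, the side of the q_ij is a point, and so is each r_k face. *)
rewrite -subr_eq0 -dot_vecR; apply/eqP => d0.
have : is_point (segment 0 (vecR i)).
  rewrite -(segment_face_eq (xi := xi)) ?dot0//.
  apply: (is_point_summand (P := xpredT)
    (K := fun k => polytope_face xi (segment 0 (vecR k)))) => //.
  apply: (@is_point_addl _ _ _ (point v)); rewrite addrC -faceE.
  suff [x ->] : is_point (\sum_(i < n) \sum_(j < n | (i < j)%N)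
      polytope_face xi (segment (basis_vec i) (basis_vec j))).
    by exists (x + vecS); rewrite pointD.
  apply: is_point_sum => k _; apply: is_point_sum => l kl.
  have := pairs_distinct _ _ kl; case: ltgtP => // d _.
    by rewrite segment_face_gt ?dot_basis_vec//; eexists.
  by rewrite segment_face_lt ?dot_basis_vec//; eexists.
move=> /is_point_segment/rowP/(_ i).
rewrite vecRE !(mxE, mulmxnE) !eqxx /= => /esym/eqP; rewrite subr_eq0 pnatr_eq1.
by case: eqP n_gt2 => // ->.
Qed.

Lemma sum_pairs (V : nmodType) (F : 'I_n -> 'I_n -> V) :
  (forall i, F i i = 0) ->
  \sum_(i < n) \sum_(j < n | (i < j)%N) (F i j + F j i) =
  \sum_(i < n) \sum_(j < n) F i j.
Proof.
move=> F0; under eq_bigr do rewrite big_split.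
rewrite big_split /= [X in _ + X](exchange_big_dep xpredT)//= -big_split.
apply: eq_bigr => i _ /=; rewrite [RHS](bigID (fun j : 'I_n => (i < j)%N)) /=.
congr (_ + _); rewrite [RHS](bigD1 i) ?ltnn//= F0 add0r.
by apply: eq_bigl => j; rewrite -leqNgt ltn_neqAle andbC.
Qed.

(** The point singled out by a generic direction; by [rank_above_mean], its k-th
coordinate is the residue of rank + #|A| modulo n, shifted to 1, ..., n. *)
Definition cyclo_vertex xi : 'rV[R]_n :=
  \row_k ((rank xi k + #|above_mean xi|).+1%:R
          - (k \in above_mean xi)%:R *+ n).

Lemma virtual_face_generic xi : generic xi ->
  virtual_face xi (cyclopermutohedron R n) = virtual (point (cyclo_vertex xi)).
Proof.
move=> [xi_inj xi_mean]; apply/virtual_face_cyclopermutohedron.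
(* Each pair {i, j} contributes F i j + F j i, which does not depend on the
   order of i and j: the basis vector at the larger coordinate. *)
pose F i j : 'rV[R]_n := if xi 0 j < xi 0 i then basis_vec i else 0.
have pairE i j : (i < j)%N ->
    polytope_face xi (segment (basis_vec i) (basis_vec j)) =
    point (F i j + F j i).
  move=> ij; rewrite /F; case: (ltgtP (xi 0 i) (xi 0 j)) => [d|d|/xi_inj eij].
  - by rewrite segment_face_gt ?dot_basis_vec// add0r.
  - by rewrite segment_face_lt ?dot_basis_vec// addr0.
  - by rewrite eij ltnn in ij.
under eq_bigr => i _.
  under eq_bigr => j ij do rewrite pairE//.
  rewrite point_sum; over.
under [in RHS]eq_bigr => i _.
  rewrite vecR_face_point; last by rewrite dot_vecR subr_eq0.
  over.
rewrite !point_sum -!pointD sum_pairs => [|i]; last by rewrite /F ltxx.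
have rankE i : \sum_j F i j = basis_vec i *+ rank xi i.
  by rewrite -big_mkcond sumr_const /rank cardsE.
rewrite (eq_bigr _ (fun i _ => rankE i)) -big_mkcond.
under [in RHS]eq_bigr do rewrite vecRE.
rewrite sumrB sumr_const.
have -> : \sum_(i in above_mean xi) basis_vec i *+ n =
    \sum_i basis_vec i *+ ((i \in above_mean xi) * n).
  by rewrite big_mkcond; apply: eq_bigr => i _; case: ifP; rewrite ?mul1n ?mul0n.
congr point; apply/rowP => k.
rewrite !(mxE, mulmxnE, basis_vec_comb).
rewrite natrM mulr_natr -natr1 natrD -[1 *+ _]/(_%:R).
ring.
Qed.

Lemma rank_lt xi k : (rank xi k < n)%N.
Proof.
rewrite -[X in (_ < X)%N]card_ord -cardsT; apply: proper_card.
by rewrite properT; apply/negP => /eqP/setP/(_ k); rewrite !inE ltxx.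
Qed.

Lemma rank_mono xi i j : xi 0 i < xi 0 j -> (rank xi i < rank xi j)%N.
Proof.
move=> ij; apply: proper_card; apply/properP; split.
  by apply/fintype.subsetP => k; rewrite !inE => /lt_trans; apply.
by exists i; rewrite !inE ?ltxx.
Qed.

Lemma rank_inj xi : (forall i j, xi 0 i = xi 0 j -> i = j) ->
  injective (rank xi).
Proof.
move=> xi_inj i j rij; apply: xi_inj.
by case: (ltgtP (xi 0 i) (xi 0 j)) => // /rank_mono; rewrite rij ltnn.
Qed.

(** The coordinates above the mean are the #|A| largest ones, so their ranks are
at least n - #|A|, while the ranks of the others are smaller. *)
Lemma rank_above_mean xi k :
  (n <= rank xi k + #|above_mean xi|)%N = (k \in above_mean xi).
Proof.
have cardC : n = (#|~: above_mean xi| + #|above_mean xi|)%N.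
  by rewrite addnC cardsC card_ord.
have [Ak|Ak] := boolP (k \in above_mean xi).
  rewrite {1}cardC leq_add2r; apply/subset_leq_card/fintype.subsetP => j.
  rewrite !inE in Ak *; rewrite -leNgt => /le_lt_trans /(_ Ak).
  by rewrite ltNge lerMn2r negb_or -ltNge => /andP[].
apply/negbTE; rewrite -ltnNge [X in (_ < X)%N]cardC ltn_add2r; apply/proper_card/properP.
split; last by exists k; rewrite !inE ?ltxx//; rewrite inE in Ak.
apply/fintype.subsetP => j; rewrite !inE in Ak *; rewrite -!leNgt in Ak * => jk.
by apply: le_trans Ak; rewrite lerMn2r ltW ?orbT.
Qed.

Lemma cyclo_vertex_perm_point xi : generic xi ->
  exists s, cyclo_vertex xi = perm_point R s.
Proof.
move=> [xi_inj _].
pose m k := (rank xi k + #|above_mean xi|)%N.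
pose b k := (k \in above_mean xi).
have mE k : (m k - b k * n < n)%N.
  have := rank_lt xi k; have := rank_above_mean xi k.
  have := max_card (above_mean xi); rewrite card_ord -/(m k) -/(b k) /m.
  by case: (b k) => /=; lia.
have s_inj : injective (fun k => Ordinal (mE k)).
  move=> i j [eij]; apply: (rank_inj xi_inj).
  have := rank_lt xi i; have := rank_above_mean xi i.
  have := rank_lt xi j; have := rank_above_mean xi j.
  rewrite -!/(m _) -!/(b _); move: eij; rewrite /m.
  by case: (b i); case: (b j) => /=; lia.
exists (perm s_inj); apply/rowP => k; rewrite !mxE permE /= -/(m k) -/(b k).
rewrite -mulrnA -natrB; last first.
  have := rank_above_mean xi k; rewrite -/(m k) -/(b k).
  by case: (b k) => //=; lia.
rewrite subSn //.
  have := rank_above_mean xi k; rewrite -/(m k) -/(b k).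
  by case: (b k) => //=; lia.
Qed.

Lemma card_inj_lt (t : 'I_n -> 'I_n) m : injective t -> (m <= n)%N ->
  #|[set j | (t j < m)%N]| = m.
Proof.
move=> t_inj mn; rewrite cardsE -sum1_card.
rewrite -[RHS](card_ord m) -[in RHS]sum1_card (big_ord_widen n (fun=> 1%N)) //.
by rewrite [RHS](reindex_inj t_inj).
Qed.

(** One coordinate above the mean suffices. With A = {k | s k = 0} the vertex
exceeds the ranks by 2 outside A and is n.-1 + 2 - n = 1 on A, so the ranks
must be s shifted cyclically down by one. *)
Lemma perm_point_cyclo_vertex s : (1 < n)%N ->
  exists2 xi, generic xi & perm_point R s = cyclo_vertex xi.
Proof.
move=> n_gt1.
have n_gt0 := ltnW n_gt1.
(* The value n ^ 2 is large enough to lift the mean above all the other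
   values, which are below n. *)
pose h (m : nat) := if m == 0%N then (n * n)%N else m.
pose xi : 'rV[R]_n := \row_k (h (s k))%:R.
pose tot := (\sum_(m < n) h m)%N.
have sum_xi : \sum_k xi 0 k = tot%:R.
  under eq_bigr do rewrite mxE.
  by rewrite -natr_sum /tot [in RHS](reindex_inj (@perm_inj _ s)).
have nxi k : xi 0 k *+ n = (h (s k) * n)%:R by rewrite mxE natrM mulr_natr.
have h0 (m : 'I_n) : m != 0%N :> nat -> (h m < n)%N.
  by rewrite /h => /negbTE ->.
have h_inj i j : h (s i) = h (s j) -> i = j.
  move=> hij; apply/(@perm_inj _ s)/val_inj => /=; move: hij; rewrite /h.
  have := ltn_ord (s i); have := ltn_ord (s j).
  by case: eqP; case: eqP; nia.
have tot_gt : (n * n < tot)%N.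
  rewrite /tot (bigD1 (Ordinal n_gt0))//= (bigD1 (Ordinal n_gt1))//= /h /=.
  by lia.
have tot_lt : (tot < n * n * n)%N.
  rewrite /tot (bigD1 (Ordinal n_gt0))//=.
  have : (\sum_(i < n | i != Ordinal n_gt0) h i <= (n - 1) * (n - 1))%N.
    rewrite -[X in (_ <= X * _)%N](_ : #|[pred i | i != Ordinal n_gt0]| = _).
      rewrite -sum_nat_const; apply: leq_sum => i i0.
      by have := h0 i i0; lia.
    by rewrite cardC1 card_ord subn1.
  have n1n1 : ((n - 1) * (n - 1) < n * n)%N by apply: ltn_mul; lia.
  have nnn : (n * n * 2 <= n * n * n)%N by rewrite leq_mul.
  move=> /leq_ltn_trans/(_ n1n1) ub; apply: leq_trans nnn.
  by rewrite muln2 -addnn {1}/h /= -addnS leq_add2l.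
have aboveE k : (k \in above_mean xi) = (s k == 0 :> nat).
  rewrite inE sum_xi nxi ltr_nat; case: eqP => [-> //|/eqP sk].
  by have := h0 _ sk; nia.
have rankE k : rank xi k = (if s k == 0%N :> nat then n.-1 else (s k).-1).
  have t_inj : injective (fun j => ord_pred (s j)).
    by move=> i j /ord_pred_inj/perm_inj.
  have tE j : ord_pred (s j) = (if s j == 0%N :> nat then n.-1 else (s j).-1) :> nat.
    rewrite /=; have := ltn_ord (s j); case: eqP => [-> _|sj sjn].
      by rewrite modn_small ?prednK// ltn_predL.
    rewrite -subn1 -addnBAC ?lt0n; last exact/eqP.
    by rewrite modnDr modn_small ?subn1// (leq_ltn_trans (leq_pred _)).
  rewrite -tE -[RHS](card_inj_lt t_inj (ltnW (ltn_ord _))).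
  apply: eq_card => j; rewrite !inE !mxE ltr_nat !tE /h.
  have := ltn_ord (s j); have := ltn_ord (s k).
  by case: eqP => sj; case: eqP => sk; nia.
have cardA : #|above_mean xi| = 1%N.
  rewrite -(cards1 ((s^-1)%g (Ordinal n_gt0))); apply: eq_card => k.
  rewrite aboveE inE; apply/eqP/eqP => [sk|->]; last by rewrite permKV.
  by apply: (@perm_inj _ s); rewrite permKV; apply: val_inj.
exists xi; first split.
- by move=> i j; rewrite !mxE => /eqP; rewrite eqr_nat => /eqP/h_inj.
- move=> i; rewrite sum_xi nxi eqr_nat.
  by have := aboveE i; rewrite inE sum_xi nxi ltr_nat; have := h0 (s i); nia.
apply/rowP => k; rewrite !mxE cardA rankE aboveE addn1.
case: eqP => [->|/eqP sk] /=; last by rewrite mul0rn subr0 prednK ?lt0n.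
by rewrite prednK// -[n.+1]addn1 natrD addrAC subrr add0r.
Qed.

End Cyclopermutohedron.

Theorem proposition2 (R : realType) (n : nat) (n_ge3 : (3 <= n)%N) :
  vert (cyclopermutohedron R n) = vert (virtual (permutohedron R n)).
Proof.
rewrite vert_permutohedron; apply/seteqP; split=> [v [xi vface]|_ [s _ <-]].
  have gen := vertex_generic n_ge3 vface.
  move: vface; rewrite virtual_face_generic// => /virtual_inj/point_inj <-.
  by have [s ->] := cyclo_vertex_perm_point gen; exists s.
have [xi gen ->] := perm_point_cyclo_vertex R s (ltnW n_ge3).
by exists xi; exact: virtual_face_generic.
Qed.
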